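(* Let $(M_{0:n},G_{0:n})$ be a Feynman--Kac model and consider the random-weight model $(M_{0:n},\bar G_{0:n})$ in which each $G_p$ is replaced by an unbiased estimate $\bar G_p$ of $G_p$ (as defined in the context). For bounded measurable $\varphi:\mathsf X\to\mathbb R$ let $\sigma_n^2(\varphi)$ be the asymptotic variance of $\gamma_n^N(\varphi)/\gamma_n(1)$ and $\bar\sigma_n^2(\varphi)$ the asymptotic variance of $\bar\gamma_n^N(\varphi)/\gamma_n(1)$. Let $s_p(x_p)=\mathrm{var}\{\bar G_p(x_p)/G_p(x_p)\}+1$ for $p\in\{0,\dots,n-1\}$ and $s_n(x_n)=1$. If for some $0<C<\infty$ $$\sup_{p\in\{0,\dots,n\}}\ \sup_{x_p\in\mathsf X}s_p(x_p)\le C+1,$$ then (i) $\bar\sigma_n^2(\varphi)\le(C+1)\,\sigma_n^2(\varphi)$ if $\varphi$ is a centred function, i.e. $\eta_n(\varphi)=0$; (ii) $\bar\sigma_n^2(1)\le(C+1)\,\sigma_n^2(1)+nC$.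
   Context: Notation: for a measure $\mu$, a non-negative kernel $K$ and a measurable function $f$, $\mu(f)=\int f\,\mathrm d\mu$ and $K(f)(z)=\int f(x)K(z,\mathrm dx)$; $(\varphi\otimes 1)(x,u)=\varphi(x)$. Feynman--Kac model. On a measurable space $(\mathsf X,\mathcal X)$, $(M_{0:n},G_{0:n})$ consists of a probability measure $M_0$, Markov kernels $M_1,\dots,M_n$ and measurable potentials $G_p:\mathsf X\to(0,\infty)$, $p\in\{0,\dots,n\}$. Its predictive marginal measures are $\gamma_0=M_0$, $\gamma_p(S)=\int\gamma_{p-1}(\mathrm dx)G_{p-1}(x)M_p(x,S)$ for $p\in\{1,\dots,n\}$, and $\eta_p=\gamma_p/\gamma_p(1)$, with $\gamma_p(1)=\gamma_p(\mathsf X)$ finite. Set $Q_p(x_{p-1},\mathrm dx_p)=G_{p-1}(x_{p-1})M_p(x_{p-1},\mathrm dx_p)$ for $p\in\{1,\dots,n\}$, $Q_{p,n}=Q_{p+1}\cdots Q_n$ (composition of kernels) for $p\in\{0,\dots,n-1\}$, and $Q_{n,n}=\mathrm{Id}$ the identity kernel. For bounded $\varphi$, $Q_{p,n}(\varphi)$ is understood $\gamma_p$-almost everywhere. Particle approximation. The bootstrap particle filter samples $\zeta_0^{i}$ i.i.d. from $\eta_0$ ($i=1,\dots,N$) and, for $p=1,\dots,n$, independently for each $i$, an ancestor index $A_{p-1}^i$ with probabilities proportional to $(G_{p-1}(\zeta_{p-1}^j))_{j=1}^N$ and then $\zeta_p^i\sim M_p(\zeta_{p-1}^{A_{p-1}^i},\cdot)$.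 Then $\eta_p^N=\frac1N\sum_i\delta_{\zeta_p^i}$ and $\gamma_n^N=\{\prod_{t=0}^{n-1}\eta_t^N(G_t)\}\,\eta_n^N$. Asymptotic variance. For any Feynman--Kac model and bounded measurable $\varphi$, the asymptotic variance of $\gamma_n^N(\varphi)/\gamma_n(1)$ (the variance in the central limit theorem for $N^{1/2}\{\gamma_n^N(\varphi)-\gamma_n(\varphi)\}/\gamma_n(1)$ as $N\to\infty$) is by definition $$\sigma_n^2(\varphi)=\sum_{p=0}^n v_{p,n}(\varphi),\qquad v_{p,n}(\varphi)=\frac{\gamma_p(1)\gamma_p(Q_{p,n}(\varphi)^2)}{\gamma_n(1)^2}-\eta_n(\varphi)^2,$$ with values in $[0,\infty]$. Random-weight model. That $\bar G_p$ is an unbiased estimate of $G_p$ means: there are a measurable space $(\mathsf U,\mathcal U)$, Markov kernels $K_p$ from $\mathsf X$ to $\mathsf U$ and measurable functions $\tilde G_p:\mathsf X\times\mathsf U\to(0,\infty)$, $p\in\{0,\dots,n\}$, such that $\bar G_p(x_p)=\tilde G_p(x_p,U_p)$ with $U_p\sim K_p(x_p,\cdot)$ and $\int_{\mathsf U}\tilde G_p(x_p,u_p)K_p(x_p,\mathrm du_p)=G_p(x_p)$ for all $x_p\in\mathsf X$. The random-weight model is the Feynman--Kac model $(\tilde M_{0:n},\tilde G_{0:n})$ on $\mathsf X\times\mathsf U$, with $\tilde x_p=(x_p,u_p)$, $\tilde M_0(\mathrm d\tilde x_0)=M_0(\mathrm dx_0)K_0(x_0,\mathrm du_0)$ and $\tilde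 M_p(\tilde x_{p-1},\mathrm d\tilde x_p)=M_p(x_{p-1},\mathrm dx_p)K_p(x_p,\mathrm du_p)$. With $\tilde\gamma_n^N$ its particle approximation, $\bar\gamma_n^N(\varphi)=\tilde\gamma_n^N(\varphi\otimes1)$, and the asymptotic variance of $\bar\gamma_n^N(\varphi)/\gamma_n(1)$ is $\bar\sigma_n^2(\varphi):=\tilde\sigma_n^2(\varphi\otimes1)$, where $\tilde\sigma_n^2$ is the asymptotic variance above computed for $(\tilde M_{0:n},\tilde G_{0:n})$. The variance in $s_p(x_p)$ is that of $\tilde G_p(x_p,U_p)/G_p(x_p)$ with $x_p$ fixed and $U_p\sim K_p(x_p,\cdot)$. *)

(* Defs.v *)
From HB Require Import structures.
From mathcomp Require Import all_boot all_order all_algebra.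
From mathcomp Require Import all_classical all_reals all_analysis.
From mathcomp Require Import kernel measurable_realfun lebesgue_measure.

Set Implicit Arguments.
Unset Strict Implicit.
Unset Printing Implicit Defensive.

Import Order.TTheory GRing.Theory Num.Theory.
Import numFieldNormedType.Exports.

Local Open Scope classical_set_scope.
Local Open Scope ring_scope.
Local Open Scope ereal_scope.

Section measure_kernel.
Context d d' (X : measurableType d) (Y : measurableType d') (R : realType).

(* The measure mu k : A |-> \int mu(dx) k(x, A). *)
Definition mkact (mu : {measure set X -> \bar R}) (k : R.-ker X ~> Y)
  (A : set Y) : \bar R := \int[mu]_x k x A.

Variables (mu : {measure set X -> \bar R}) (k : R.-ker X ~> Y).

Let mkact0 : mkact mu k set0 = 0.
Proof. by apply: integral0_eq => x _; rewrite measure0. Qed.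

Let mkact_ge0 A : 0 <= mkact mu k A.
Proof. exact: integral_ge0. Qed.

Let mkact_sigma_additive : semi_sigma_additive (mkact mu k).
Proof.
move=> F mF tF mUF; rewrite [X in _ --> X](_ : _ =
  \int[mu]_x (\sum_(n <oo) k x (F n))); last first.
  apply: eq_integral => x _.
  by apply/esym/cvg_lim => //; exact/measure_semi_sigma_additive.
apply/cvg_closeP; split.
  by apply: is_cvg_nneseries => n _ _; exact: integral_ge0.
by rewrite closeE// integral_nneseries// => n; exact: measurable_kernel.
Qed.

HB.instance Definition _ := isMeasure.Build _ _ _ (mkact mu k)
  mkact0 mkact_ge0 mkact_sigma_additive.

End measure_kernel.

Section kernel_composition.
Context d1 d2 d3 (X : measurableType d1) (Y : measurableType d2)
  (Z : measurableType d3) (R : realType).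
Variables (k : R.-ker X ~> Y) (l : R.-ker Y ~> Z).

(* Same function as the library's kcomp_noparam, whose kernel structure is
   however only available for subprobability kernels. *)
Definition kcompose (x : X) : {measure set Z -> \bar R} := mkact (k x) l.

Let measurable_kcompose U : measurable U ->
  measurable_fun [set: X] (kcompose ^~ U).
Proof.
move=> mU; apply: (measurable_fun_integral_kernel (l := k)).
- by move=> V mV; exact: measurable_kernel.
- by [].
- exact: measurable_kernel.
Qed.

HB.instance Definition _ := isKernel.Build _ _ _ _ _ kcompose
  measurable_kcompose.

End kernel_composition.

Section kernel_weight.
Context d d' (X : measurableType d) (Y : measurableType d') (R : realType).

(* The kernel G(x) M(x, dy). *)
Definition kweight (G : {mfun X >-> R}) (G_ge0 : forall x, (0 <= G x)%R)
  (M : R.-ker X ~> Y) (x : X) : {measure set Y -> \bar R} :=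
  mscale (NngNum (G_ge0 x)) (M x).

Variables (G : {mfun X >-> R}) (G_ge0 : forall x, (0 <= G x)%R).
Variable M : R.-ker X ~> Y.

Let measurable_kweight U : measurable U ->
  measurable_fun [set: X] (kweight G_ge0 M ^~ U).
Proof.
move=> mU; rewrite /kweight /mscale /=.
apply: emeasurable_funM; last exact: measurable_kernel.
exact/measurable_EFinP.
Qed.

HB.instance Definition _ := isKernel.Build _ _ _ _ _ (kweight G_ge0 M)
  measurable_kweight.

End kernel_weight.

Section kernel_pair.
Context d d' (X : measurableType d) (U : measurableType d') (R : realType).

(* The kernel delta_x(dx') K(x, du) from X to X * U, so that
   mkact mu (kpair K) is the measure mu(dx) K(x, du). *)
Definition kpair_fun (K : R.-pker X ~> U) (x : X) (A : set (X * U)) : \bar R :=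
  K x (xsection A x).

Variable K : R.-pker X ~> U.

Let kpair0 x : kpair_fun K x set0 = 0.
Proof. by rewrite /kpair_fun xsection0 measure0. Qed.

Let kpair_ge0 x A : 0 <= kpair_fun K x A.
Proof. exact: measure_ge0. Qed.

Let kpair_sigma_additive x : semi_sigma_additive (kpair_fun K x).
Proof.
move=> F mF tF mUF; rewrite /kpair_fun xsection_bigcup.
apply: measure_semi_sigma_additive.
- by move=> n; exact: measurable_xsection.
- exact: trivIset_xsection.
- by apply: bigcup_measurable => n _; exact: measurable_xsection.
Qed.

HB.instance Definition _ x := isMeasure.Build _ _ _ (kpair_fun K x)
  (kpair0 x) (kpair_ge0 x) (@kpair_sigma_additive x).

Definition kpair (x : X) : {measure set (X * U) -> \bar R} := kpair_fun K x.

Let measurable_kpair A : measurable A -> measurable_fun [set: X] (kpair ^~ A).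
Proof.
by move=> mA; apply: measurable_fun_xsection_finite_kernel; rewrite inE.
Qed.

HB.instance Definition _ := isKernel.Build _ _ _ _ _ kpair measurable_kpair.

Let kpair_prob x : kpair x [set: X * U] = 1.
Proof. by rewrite /= /kpair_fun xsectionE preimage_setT prob_kernel. Qed.

HB.instance Definition _ := Kernel_isProbability.Build _ _ _ _ _ kpair
  kpair_prob.

End kernel_pair.

Section markov.
Context d d' (X : measurableType d) (Y : measurableType d') (R : realType).

(* The values of a Markov kernel, with the structure of probability measure
   that the library does not infer for them. *)
Definition kprob_fun (k : R.-pker X ~> Y) (x : X) : set Y -> \bar R := k x.

HB.instance Definition _ (k : R.-pker X ~> Y) (x : X) :=
  Measure.copy (kprob_fun k x) (k x).

HB.instance Definition _ (k : R.-pker X ~> Y) (x : X) :=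
  Measure_isProbability.Build _ _ _ (kprob_fun k x) (prob_kernel x).

Definition kprob (k : R.-pker X ~> Y) (x : X) : probability Y R :=
  kprob_fun k x.

Variables (P : probability X R) (k : R.-pker X ~> Y).

Let mkact_prob : mkact P k [set: Y] = 1.
Proof.
rewrite /mkact; under eq_integral do rewrite prob_kernel.
rewrite integral_cst// mul1e; exact: probability_setT.
Qed.

HB.instance Definition _ := Measure_isProbability.Build _ _ _ (mkact P k)
  mkact_prob.

End markov.

Section feynman_kac.
Context d (X : measurableType d) (R : realType).

(* M_0 is fk_M0. Sequences are indexed by nat: a model with horizon n only uses
   fk_M p for 1 <= p <= n and fk_G p for p <= n, and any such finite family
   extends to all indices. *)
Record feynmanKac := FeynmanKac {
  fk_M0 : probability X R ;
  fk_M : nat -> R.-pker X ~> X ;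
  fk_G : nat -> {mfun X >-> R} ;
  fk_G_gt0 : forall p x, (0 < fk_G p x)%R }.

Variable F : feynmanKac.

Definition fk_G_ge0 p x : (0 <= fk_G F p x)%R := ltW (fk_G_gt0 F p x).

(* fk_Q p is Q_{p+1}(x, dy) = G_p(x) M_{p+1}(x, dy). *)
Definition fk_Q (p : nat) : R.-ker X ~> X :=
  kweight (@fk_G_ge0 p) (fk_M F p.+1).

Fixpoint fk_gamma (p : nat) : {measure set X -> \bar R} :=
  if p is q.+1 then mkact (fk_gamma q) (fk_Q q) else fk_M0 F.

(* gamma_p / gamma_p(1); the second argument of mnormalize is only a default
   value for measures of mass 0 or +oo. *)
Definition fk_eta (p : nat) : probability X R :=
  mnormalize (fk_gamma p) (fk_M0 F).

(* fk_Qiter p m is Q_{p+1} ... Q_{p+m}. *)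
Fixpoint fk_Qiter (p m : nat) : R.-ker X ~> X :=
  if m is m'.+1 then kcompose (fk_Q p) (fk_Qiter p.+1 m')
  else kdirac (@measurable_id _ X setT).

Definition fk_Qpn (p n : nat) : R.-ker X ~> X := fk_Qiter p (n - p).

(* Q_{p,n}(phi), extended-real valued: the integral of a bounded phi may be
   undefined at points where Q_{p,n}(1) = +oo, a gamma_p-negligible set when
   gamma_n(1) is finite. *)
Definition fk_Qphi (p n : nat) (phi : X -> R) (x : X) : \bar R :=
  \int[fk_Qpn p n x]_y (phi y)%:E.

Definition fk_v (p n : nat) (phi : X -> R) : \bar R :=
  fk_gamma p setT * (\int[fk_gamma p]_x (fk_Qphi p n phi x) ^+ 2)
    / (fk_gamma n setT) ^+ 2
  - (\int[fk_eta n]_x (phi x)%:E) ^+ 2.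

(* The asymptotic variance sigma_n^2(phi). *)
Definition fk_asymptotic_variance (n : nat) (phi : X -> R) : \bar R :=
  \sum_(0 <= p < n.+1) fk_v p n phi.

End feynman_kac.

Section random_weight.
Context d d' (X : measurableType d) (U : measurableType d') (R : realType).

(* The kernel ((x, u), d(y, v)) |-> M(x, dy) K(y, dv). *)
Definition kmove (M : R.-pker X ~> X) (K : R.-pker X ~> U) (xu : X * U) :
  {measure set (X * U) -> \bar R} := mkact (M xu.1) (kpair K).

Section kmove_kernel.
Variables (M : R.-pker X ~> X) (K : R.-pker X ~> U).

Let measurable_kmove A : measurable A ->
  measurable_fun [set: X * U] (kmove M K ^~ A).
Proof.
move=> mA; apply: (measurableT_comp (f := kcompose M (kpair K) ^~ A)) => //.
exact: measurable_kernel.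
Qed.

HB.instance Definition _ := isKernel.Build _ _ _ _ _ (kmove M K)
  measurable_kmove.

Let kmove_prob xu : kmove M K xu [set: X * U] = 1.
Proof. exact: (probability_setT (mkact (kprob M xu.1) (kpair K))). Qed.

HB.instance Definition _ := Kernel_isProbability.Build _ _ _ _ _ (kmove M K)
  kmove_prob.

End kmove_kernel.

Variables (F : feynmanKac X R) (K : nat -> R.-pker X ~> U).
Variables (Gt : nat -> {mfun (X * U)%type >-> R}).
Hypothesis Gt_gt0 : forall p xu, (0 < Gt p xu)%R.

(* Gt p (x, U_p) with U_p ~ K p x is an unbiased estimate of G_p(x), p <= n. *)
Definition unbiased_weights (n : nat) : Prop :=
  forall p x, (p <= n)%N ->
    \int[K p x]_u (Gt p (x, u))%:E = (fk_G F p x)%:E.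

Definition random_weight_model : feynmanKac (X * U)%type R :=
  FeynmanKac (mkact (fk_M0 F) (kpair (K 0))) (fun p => kmove (fk_M F p) (K p))
    Gt_gt0.

(* s_p(x) for p <= n; in particular s_n(x) = 1. *)
Definition weight_s (n p : nat) (x : X) : \bar R :=
  if (p < n)%N
  then 'V_(kprob (K p) x)[fun u => (Gt p (x, u) / fk_G F p x)%R] + 1
  else 1.

End random_weight.

(* Main.v *)
Require Import Defs.
From HB Require Import structures.
From mathcomp Require Import all_boot all_order all_algebra.
From mathcomp Require Import all_classical all_reals all_analysis.
From mathcomp Require Import lra.
From mathcomp Require Import kernel measurable_realfun lebesgue_measure.

Import Order.TTheory GRing.Theory Num.Theory.
Import numFieldNormedType.Exports.

Local Open Scope classical_set_scope.
Local Open Scope ring_scope.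
Local Open Scope ereal_scope.

(** Integrating out the weight variables U turns the predictive measures of the
    random-weight model into those of the original one, and since the weight at
    time p is the only one that is not averaged,
      Q~_{p,n}(phi (x) 1)(x, u) = (G~_p(x, u) / G_p(x)) Q_{p,n}(phi)(x)  for p < n.
    The second moment of the relative weight under K_p(x, .) is s_p(x) <= C + 1,
    so the first term of each v_{p,n} grows at most by the factor C + 1. For a
    centred phi this is (i). For phi = 1 the terms -1 leave an excess C for each
    p < n, while the terms p = n vanish in both models. *)

(** * Integrals of nonnegative functions against the kernel constructions *)

Section integral_against_kernels.
Context {R : realType} {d d' : measure_display}.
Context {X : measurableType d} {Y : measurableType d'}.

Lemma measurable_integral_kernel (k : R.-ker X ~> Y) (f : Y -> \bar R) :
  (forall y, 0 <= f y) -> measurable_fun [set: Y] f ->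
  measurable_fun [set: X] (fun x => \int[k x]_y f y).
Proof.
move=> f0 mf; apply: (measurable_fun_integral_kernel (l := k)) => // V mV.
exact: measurable_kernel.
Qed.

Section mkact.
Variables (mu : {measure set X -> \bar R}) (k : R.-ker X ~> Y).

Import HBNNSimple.

Let integral_mkact_nnsfun (f : {nnsfun Y >-> R}) :
  \int[mkact mu k]_y (f y)%:E = \int[mu]_x \int[k x]_y (f y)%:E.
Proof.
have fk0 r x : 0 <= r%:E * k x (f @^-1` [set r]).
  apply: (mulemu_ge0 (fun s => f @^-1` [set s])) => r0.
  exact: preimage_nnfun0.
under [RHS]eq_integral do rewrite integralT_nnsfun sintegralE.
rewrite integralT_nnsfun sintegralE ge0_integral_fsum//; last first.
  by move=> r; apply: measurable_funeM; exact: measurable_kernel.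
apply: eq_fsbigr => r _; rewrite /= /mkact.
(* The finite sums range over all real values [r]; for negative [r] the preimage under [f] is empty
   and both terms vanish. *)
have [r0|r0] := leP 0%R r.
  by rewrite ge0_integralZl//; exact: measurable_kernel.
by rewrite !integral0_eq ?mule0// => x _; rewrite preimage_nnfun0// measure0 ?mule0.
Qed.

(** The simple case passes to the limit by monotone convergence, applied to the inner integrals
    against [k x] and to the outer one against [mu]. *)
Lemma ge0_integral_mkact (f : Y -> \bar R) :
  (forall y, 0 <= f y) -> measurable_fun [set: Y] f ->
  \int[mkact mu k]_y f y = \int[mu]_x \int[k x]_y f y.
Proof.
move=> f0 mf; pose g := nnsfun_approx measurableT mf.
have g0 n y : 0 <= (g n y)%:E by rewrite lee_fin.
have mg n : measurable_fun [set: Y] (EFin \o g n) by exact/measurable_EFinP.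
have ndg y : {homo (fun n => (g n y)%:E) : m n / (m <= n)%N >-> m <= n}.
  by move=> m n mn; rewrite lee_fin; exact/lefP/nd_nnsfun_approx.
(* Stated for arbitrary [nu] because it serves both [mkact mu k] and every [k x]. *)
have int_lim (nu : {measure set Y -> \bar R}) :
    \int[nu]_y f y = limn (fun n => \int[nu]_y (g n y)%:E).
  rewrite -monotone_convergence//; apply: eq_integral => y _.
  by apply/esym/cvg_lim => //; exact: cvg_nnsfun_approx.
rewrite int_lim; under eq_fun do rewrite integral_mkact_nnsfun.
rewrite -monotone_convergence//.
- by apply: eq_integral => x _; rewrite int_lim.
- by move=> n; apply: measurable_integral_kernel (g0 n) (mg n).
- by move=> n x _; exact: integral_ge0.
- by move=> x _ m n mn; apply: ge0_le_integral => //;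
    [exact: mg|exact: mg|move=> y _; exact: ndg].
Qed.

End mkact.

Lemma ge0_integral_kweight (G : {mfun X >-> R}) (G0 : forall x, (0 <= G x)%R)
    (M : R.-ker X ~> Y) x (f : Y -> \bar R) :
  (forall y, 0 <= f y) -> measurable_fun [set: Y] f ->
  \int[kweight G0 M x]_y f y = (G x)%:E * \int[M x]_y f y.
Proof. by move=> f0 mf; rewrite ge0_integral_mscale. Qed.

End integral_against_kernels.

Section integral_pair_kernel.
Context {R : realType} {d d' : measure_display}.
Context {X : measurableType d} {Y : measurableType d'}.
Variable K : R.-pker X ~> Y.

(** [kpair K x] is the image of [K x] under the map sending [y] to [(x, y)]. *)
Lemma ge0_integral_kpair x (f : X * Y -> \bar R) :
  (forall z, 0 <= f z) -> measurable_fun [set: X * Y] f ->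
  \int[kpair K x]_z f z = \int[K x]_y f (x, y).
Proof.
move=> f0 mf.
rewrite (@eq_measure_integral _ _ _ _ (pushforward (K x) (pair x))).
  by rewrite ge0_integral_pushforward.
by move=> A mA _; rewrite /= /kpair_fun /pushforward xsectionE.
Qed.

Lemma ge0_integral_mkact_kpair (mu : {measure set X -> \bar R})
    (f : X * Y -> \bar R) :
  (forall z, 0 <= f z) -> measurable_fun [set: X * Y] f ->
  \int[mkact mu (kpair K)]_z f z = \int[mu]_x \int[K x]_y f (x, y).
Proof.
move=> f0 mf; rewrite ge0_integral_mkact//.
by apply: eq_integral => x _; rewrite ge0_integral_kpair.
Qed.

Lemma measurable_integral_section (f : X * Y -> \bar R) :
  (forall z, 0 <= f z) -> measurable_fun [set: X * Y] f ->
  measurable_fun [set: X] (fun x => \int[K x]_y f (x, y)).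
Proof.
move=> f0 mf; under eq_fun do rewrite -ge0_integral_kpair//.
exact: measurable_integral_kernel.
Qed.

End integral_pair_kernel.

(* No definedness condition, since +oo - oo = -oo by convention. *)
Lemma muleDr_gt0 (R : realType) (r : R) (x y : \bar R) : (0 < r)%R ->
  r%:E * (x + y) = r%:E * x + r%:E * y.
Proof.
move=> r0; move: x y => [x| |] [y| |] //=;
  rewrite ?gt0_muley ?gt0_muleNy ?lte_fin//.
by rewrite -!EFinD -!EFinM mulrDr.
Qed.

(** * Semigroup, masses and variance terms of a Feynman-Kac model *)

Section feynman_kac_integrals.
Context {R : realType} {d : measure_display} {X : measurableType d}.
Variable F : feynmanKac X R.

Lemma ge0_integral_QiterS p m x (f : X -> \bar R) :
  (forall y, 0 <= f y) -> measurable_fun [set: X] f ->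
  \int[fk_Qiter F p m.+1 x]_y f y =
  (fk_G F p x)%:E * \int[fk_M F p.+1 x]_y \int[fk_Qiter F p.+1 m y]_z f z.
Proof.
move=> f0 mf; rewrite [LHS]ge0_integral_mkact// ge0_integral_kweight//.
- by move=> y; exact: integral_ge0.
- exact: measurable_integral_kernel.
Qed.

Lemma measurable_fk_Qphi p n (phi : X -> R) : measurable_fun [set: X] phi ->
  measurable_fun [set: X] (fk_Qphi F p n phi).
Proof.
move=> mphi; have mEphi : measurable_fun [set: X] (EFin \o phi).
  exact/measurable_EFinP.
rewrite /fk_Qphi; under eq_fun do rewrite integralE.
apply: emeasurable_funB; apply: measurable_integral_kernel => //.
- exact: measurable_funepos.
- exact: measurable_funeneg.
Qed.

Lemma fk_Qphi_id n (phi : X -> R) x : measurable_fun [set: X] phi ->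
  fk_Qphi F n n phi x = (phi x)%:E.
Proof.
move=> mphi; rewrite /fk_Qphi /fk_Qpn subnn [LHS]integral_dirac//.
- by rewrite diracT mul1e.
- exact/measurable_EFinP.
Qed.

(** The next mass is the integral of the potential; if it were zero, the potential would vanish
    almost everywhere, which positivity allows only under a null measure. *)
Lemma fk_gamma_mass_gt0 p : 0 < fk_gamma F p [set: X].
Proof.
elim: p => [|p IH]; first by rewrite /= probability_setT.
rewrite lt0e measure_ge0 andbT; apply/eqP => /= gamma0.
have /ae_eq_integral_abs : \int[fk_gamma F p]_x `|(fk_G F p x)%:E| = 0.
  rewrite -[RHS]gamma0 /mkact; apply: eq_integral => x _.
  rewrite gee0_abs ?lee_fin ?fk_G_ge0//.
  by rewrite -[RHS]/((fk_G F p x)%:E * fk_M F p.+1 x setT) prob_kernel mule1.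
case=> //; first exact/measurable_EFinP.
(* The null set [N] contains every point where the potential is nonzero, hence the whole space. *)
move=> N [mN N0 GN]; have : fk_gamma F p [set: X] <= 0.
  rewrite -N0 le_measure ?inE// => x _; apply: GN => /= /(_ Logic.I) [] G0.
  by have := fk_G_gt0 F p x; rewrite G0 ltxx.
by rewrite leNgt IH.
Qed.

(** The part of [fk_v] that precedes the subtracted squared mean; the factor [C + 1] acts on this
    part only. *)
Definition fk_relative_moment (p n : nat) (phi : X -> R) : \bar R :=
  fk_gamma F p setT * (\int[fk_gamma F p]_x (fk_Qphi F p n phi x) ^+ 2)
    / (fk_gamma F n setT) ^+ 2.

Lemma fk_v_cst1 p n :
  fk_v F p n (cst 1%R) = fk_relative_moment p n (cst 1%R) - 1.
Proof.
have eta1 : \int[fk_eta F n]_x cst 1 x = 1.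
  by rewrite integral_cst// mul1e; exact: probability_setT.
by congr (_ - _); rewrite [X in X ^+ 2]eta1 expe2 mule1.
Qed.

(** The relative moment is the squared mass divided by itself, and this quotient is 1 because the
    mass is positive and finite. *)
Lemma fk_v_terminal_cst1 n :
  fk_gamma F n setT < +oo -> fk_v F n n (cst 1%R) = 0.
Proof.
move=> gfin; have gn0 := fk_gamma_mass_gt0 n.
have gfin_num : fk_gamma F n setT \is a fin_num by rewrite ge0_fin_numE.
have moment1 : \int[fk_gamma F n]_x (fk_Qphi F n n (cst 1%R) x) ^+ 2 =
    fk_gamma F n setT.
  rewrite -[RHS]mul1e -integral_cst//; apply: eq_integral => x _.
  by rewrite fk_Qphi_id// expe2 mule1.
rewrite fk_v_cst1 /fk_relative_moment moment1 -expe2 divee ?subee// ?fin_numX//.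
by rewrite expe2 mule_eq0 orbb gt_eqF.
Qed.

End feynman_kac_integrals.

(** * Integrating out the random weights *)

Section random_weight_integrals.
Context {R : realType} {d d' : measure_display}.
Context {X : measurableType d} {U : measurableType d'}.
Variables (n : nat) (F : feynmanKac X R) (K : nat -> R.-pker X ~> U).
Variables (Gt : nat -> {mfun (X * U)%type >-> R}).
Hypothesis Gt_gt0 : forall p xu, (0 < Gt p xu)%R.
Hypothesis Gt_unbiased : unbiased_weights F K Gt n.

Local Notation F' := (random_weight_model F K Gt_gt0).

Lemma measurable_EFin_section p x : measurable_fun [set: U] (fun u => (Gt p (x, u))%:E).
Proof.
by apply/measurable_EFinP; exact: measurableT_comp (measurable_pair1 _).
Qed.

Lemma ge0_integral_unbiased p x (c : \bar R) : (p <= n)%N -> 0 <= c ->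
  \int[K p x]_u ((Gt p (x, u))%:E * c) = (fk_G F p x)%:E * c.
Proof.
move=> pn c0; rewrite ge0_integralZr ?Gt_unbiased//.
- exact: measurable_EFin_section.
- by move=> u _; rewrite lee_fin ltW.
Qed.

Lemma ge0_integral_random_weight_Q p x u (f : X * U -> \bar R) :
  (forall z, 0 <= f z) -> measurable_fun [set: X * U] f ->
  \int[fk_Q F' p (x, u)]_z f z = (Gt p (x, u))%:E *
    \int[fk_M F p.+1 x]_y \int[K p.+1 y]_v f (y, v).
Proof.
by move=> f0 mf; rewrite ge0_integral_kweight// [in LHS]ge0_integral_mkact_kpair.
Qed.

(** Induction on [p] for all [f] at once: after one step back the variable [u] enters only through
    [Gt p (x, u)], which averages to the original potential. *)
Lemma ge0_integral_random_weight_gamma p (f : X * U -> \bar R) : (p <= n)%N ->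
  (forall z, 0 <= f z) -> measurable_fun [set: X * U] f ->
  \int[fk_gamma F' p]_z f z = \int[fk_gamma F p]_x \int[K p x]_u f (x, u).
Proof.
elim: p f => [|p IH] f pn f0 mf; first exact: ge0_integral_mkact_kpair.
have Kf0 y : 0 <= \int[K p.+1 y]_v f (y, v) by exact: integral_ge0.
have mKf : measurable_fun [set: X] (fun y => \int[K p.+1 y]_v f (y, v)).
  exact: measurable_integral_section.
rewrite [LHS]ge0_integral_mkact// IH ?(ltnW pn)//; first last.
- exact: measurable_integral_kernel.
- by move=> z; exact: integral_ge0.
rewrite [RHS]ge0_integral_mkact//; apply: eq_integral => x _.
under eq_integral do rewrite ge0_integral_random_weight_Q//.
by rewrite ge0_integral_unbiased ?(ltnW pn) ?ge0_integral_kweight ?integral_ge0.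
Qed.

Lemma ge0_integral_random_weight_QiterS p m x u (f : X -> \bar R) :
  (forall y, 0 <= f y) -> measurable_fun [set: X] f ->
  \int[fk_Qiter F' p m.+1 (x, u)]_z f z.1 = (Gt p (x, u))%:E *
    \int[fk_M F p.+1 x]_y \int[K p.+1 y]_v
      \int[fk_Qiter F' p.+1 m (y, v)]_z f z.1.
Proof.
move=> f0 mf; have mf1 : measurable_fun [set: X * U] (f \o fst).
  exact: measurableT_comp.
rewrite ge0_integral_QiterS// [in LHS]ge0_integral_mkact_kpair//.
- by move=> z; exact: integral_ge0.
- exact: measurable_integral_kernel.
Qed.

(** Averaging over the initial [u] as well makes the induction on [m] close: later weights are
    averaged by the induction hypothesis at [p.+1], and the leading weight by unbiasedness. *)
Lemma ge0_integral_random_weight_Qiter p m x (f : X -> \bar R) : (p + m <= n)%N ->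
  (forall y, 0 <= f y) -> measurable_fun [set: X] f ->
  \int[K p x]_u \int[fk_Qiter F' p m (x, u)]_z f z.1 =
  \int[fk_Qiter F p m x]_y f y.
Proof.
move=> + f0 mf; have mf1 : measurable_fun [set: X * U] (f \o fst).
  exact: measurableT_comp.
elim: m p x => [|m IH] p x pmn.
  transitivity (\int[K p x]_u cst (f x) u).
    by apply: eq_integral => u _; rewrite [LHS]integral_dirac// diracT mul1e.
  by rewrite integral_cst// prob_kernel mule1 integral_dirac// diracT mul1e.
rewrite addnS -addSn in pmn.
rewrite ge0_integral_QiterS//.
under eq_integral do rewrite ge0_integral_random_weight_QiterS//.
under eq_integral do under eq_integral do rewrite IH//.
rewrite ge0_integral_unbiased//.
- by rewrite (leq_trans _ pmn)// addSn ltnW// ltnS leq_addr.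
- by do 2 (apply: integral_ge0 => ? _).
Qed.

(** Here [u] is fixed, so the first weight stays random while all later ones average out. Since
    [p < n], at least one step can be split off. *)
Lemma ge0_integral_random_weight_Qpn p x u (f : X -> \bar R) : (p < n)%N ->
  (forall y, 0 <= f y) -> measurable_fun [set: X] f ->
  \int[fk_Qpn F' p n (x, u)]_z f z.1 =
  (Gt p (x, u) / fk_G F p x)%:E * \int[fk_Qpn F p n x]_y f y.
Proof.
move=> pn f0 mf; rewrite /fk_Qpn -(subnSK pn) ge0_integral_random_weight_QiterS//.
under eq_integral do rewrite ge0_integral_random_weight_Qiter ?subnKC//.
rewrite ge0_integral_QiterS// muleA -EFinM divfK//.
by rewrite gt_eqF// fk_G_gt0.
Qed.

Lemma fk_Qphi_random_weight p x u (phi : X -> R) : (p < n)%N ->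
  measurable_fun [set: X] phi ->
  fk_Qphi F' p n (phi \o fst) (x, u) =
  (Gt p (x, u) / fk_G F p x)%:E * fk_Qphi F p n phi x.
Proof.
move=> pn mphi; have mEphi : measurable_fun [set: X] (EFin \o phi).
  exact/measurable_EFinP.
(* The relative weight is positive, so it distributes over the positive and negative parts even
   where both have infinite integral. *)
rewrite /fk_Qphi integralE [in RHS]integralE muleDr_gt0; last first.
  by rewrite divr_gt0// fk_G_gt0.
rewrite muleN; congr (_ - _).
- rewrite -(ge0_integral_random_weight_Qpn _ _ u)//; last exact: measurable_funepos.
  by apply: eq_integral => z _; rewrite !funeposE.
- rewrite -(ge0_integral_random_weight_Qpn _ _ u)//; last exact: measurable_funeneg.
  by apply: eq_integral => z _; rewrite !funenegE.
Qed.

(** By unbiasedness the relative weight has mean 1, so its second moment is its variance plus 1. *)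
Lemma integral_sqr_relative_weight p x : (p < n)%N ->
  \int[K p x]_u ((Gt p (x, u) / fk_G F p x) ^+ 2)%:E = weight_s F K Gt n p x.
Proof.
move=> pn; rewrite /weight_s pn.
have G0 := fk_G_gt0 F p x.
pose w u := (Gt p (x, u) / fk_G F p x)%R.
have w0 u : (0 <= w u)%R by rewrite divr_ge0// ltW.
have mw : measurable_fun [set: U] w.
  apply: measurable_funM => //; apply/measurable_EFinP.
  exact: measurable_EFin_section.
have intw : \int[K p x]_u (w u)%:E = 1.
  under eq_integral do rewrite EFinM.
  rewrite ge0_integral_unbiased ?(ltnW pn) ?lee_fin ?invr_ge0 ?(ltW G0)//.
  by rewrite -EFinM divff// gt_eqF.
have varw : 'V_(kprob (K p) x)[w] = \int[K p x]_u ((w u - 1) ^+ 2)%:E.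
  rewrite /variance unlock unlock.
  by rewrite -[X in fine X]/(\int[K p x]_u (w u)%:E) intw.
(* w^2 + 1 = (w - 1)^2 + 2 w, with both sides sums of nonnegative terms. *)
have : \int[K p x]_u ((w u ^+ 2)%:E + 1) =
       \int[K p x]_u (((w u - 1) ^+ 2)%:E + 2%:E * (w u)%:E).
  apply: eq_integral => u _; rewrite -EFinM -!EFinD; congr EFin.
  by rewrite sqrrB1 mulr_natl addrAC subrK.
have msqr (g : U -> R) : measurable_fun [set: U] g ->
    measurable_fun [set: U] (fun u => (g u ^+ 2)%:E).
  by move=> mg; apply/measurable_EFinP; exact: measurable_funX.
rewrite ge0_integralD//; [|by move=> u _; rewrite lee_fin sqr_ge0|exact: msqr].
rewrite ge0_integralD//; last first.
- by apply/measurable_EFinP; exact: measurable_funM.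
- by move=> u _; rewrite lee_fin mulr_ge0.
- by apply: msqr; exact: measurable_funB.
- by move=> u _; rewrite lee_fin sqr_ge0.
rewrite integral_cst// prob_kernel mule1 ge0_integralZl_EFin//; last 2 first.
- by move=> u _; rewrite lee_fin.
- exact/measurable_EFinP.
(* Only the finite term 1 is cancelled, so an infinite variance is covered. *)
rewrite intw mule1 -varw => /(congr1 (fun y => y - 1)).
by rewrite addeK// => ->; rewrite -addeA -EFinB; congr (_ + _%:E); lra.
Qed.

Lemma random_weight_gamma_mass p : (p <= n)%N ->
  fk_gamma F' p [set: X * U] = fk_gamma F p [set: X].
Proof.
move=> pn; rewrite -[LHS]mul1e -integral_cst//.
rewrite ge0_integral_random_weight_gamma// -[RHS]mul1e -integral_cst//.
by apply: eq_integral => x _; rewrite [LHS]integral_cst// prob_kernel mule1.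
Qed.

(** For fixed [x] the squared relative weight is the only factor depending on [u]; its integral is
    [weight_s], which is bounded by [c] before integrating over [x]. *)
Lemma le_integral_sqr_fk_Qphi_random_weight p (phi : X -> R) (c : R) :
  (p < n)%N -> measurable_fun [set: X] phi -> (0 <= c)%R ->
  (forall x, weight_s F K Gt n p x <= c%:E) ->
  \int[fk_gamma F' p]_z (fk_Qphi F' p n (phi \o fst) z) ^+ 2 <=
  c%:E * \int[fk_gamma F p]_x (fk_Qphi F p n phi x) ^+ 2.
Proof.
move=> pn mphi c0 sc.
have mQ : measurable_fun [set: X] (fun x => fk_Qphi F p n phi x ^+ 2).
  by have mQphi := measurable_fk_Qphi F p n _ mphi; exact: emeasurable_funM.
have mQ' : measurable_fun [set: X * U]
    (fun z => fk_Qphi F' p n (phi \o fst) z ^+ 2).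
  have mQphi := measurable_fk_Qphi F' p n _ (measurableT_comp mphi measurable_fst).
  exact: emeasurable_funM.
rewrite ge0_integral_random_weight_gamma ?(ltnW pn)//; last first.
  by move=> z; exact: sqre_ge0.
rewrite -ge0_integralZl_EFin//; last by move=> x _; exact: sqre_ge0.
apply: ge0_le_integral => //.
- by move=> x _; apply: integral_ge0 => u _; exact: sqre_ge0.
- exact: (measurable_integral_section (K p) _ (fun z => sqre_ge0 _) mQ').
- exact: measurable_funeM.
move=> x _; under eq_integral do
  rewrite fk_Qphi_random_weight// expe2 muleACA -EFinM -expr2 -expe2.
rewrite ge0_integralZr ?sqre_ge0//.
- by rewrite integral_sqr_relative_weight// lee_wpmul2r ?sqre_ge0.
- apply/measurable_EFinP; apply: measurable_funX; apply: measurable_funM => //.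
  by apply/measurable_EFinP; exact: measurable_EFin_section.
- by move=> u _; rewrite lee_fin sqr_ge0.
Qed.

(** At the terminal time the semigroup is the identity, so the integrand does not depend on [u]. *)
Lemma integral_sqr_fk_Qphi_random_weight_id (phi : X -> R) :
  measurable_fun [set: X] phi ->
  \int[fk_gamma F' n]_z (fk_Qphi F' n n (phi \o fst) z) ^+ 2 =
  \int[fk_gamma F n]_x (fk_Qphi F n n phi x) ^+ 2.
Proof.
move=> mphi; have mphi1 : measurable_fun [set: X * U] (phi \o fst).
  exact: measurableT_comp.
under eq_integral do rewrite fk_Qphi_id//.
under [RHS]eq_integral do rewrite fk_Qphi_id//.
rewrite ge0_integral_random_weight_gamma//.
- apply: eq_integral => x _.
  rewrite -[LHS]/(\int[K n x]_u cst ((phi x)%:E ^+ 2) u).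
  by rewrite integral_cst// prob_kernel mule1.
- by move=> z; exact: sqre_ge0.
- by apply: emeasurable_funM; exact/measurable_EFinP.
Qed.

End random_weight_integrals.

(** * Comparison of the variance terms at each time *)

Section asymptotic_variance_bounds.
Context {R : realType} {d d' : measure_display}.
Context {X : measurableType d} {U : measurableType d'}.

Variables (n : nat) (F : feynmanKac X R) (K : nat -> R.-pker X ~> U).
Variables (Gt : nat -> {mfun (X * U)%type >-> R}).
Hypothesis Gt_gt0 : forall p xu, (0 < Gt p xu)%R.
Hypothesis Gt_unbiased : unbiased_weights F K Gt n.
Variable C : R.
Hypothesis C_gt0 : (0 < C)%R.
Hypothesis s_le : forall p x, (p <= n)%N -> weight_s F K Gt n p x <= (C + 1)%:E.

Local Notation F' := (random_weight_model F K Gt_gt0).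

Lemma le_random_weight_relative_moment p (phi : X -> R) : (p <= n)%N ->
  measurable_fun [set: X] phi ->
  fk_relative_moment F' p n (phi \o fst) <=
  (C + 1)%:E * fk_relative_moment F p n phi.
Proof.
move=> pn mphi; rewrite /fk_relative_moment.
rewrite !(random_weight_gamma_mass n)// muleA lee_wpmul2r ?inve_ge0 ?sqre_ge0//.
rewrite muleCA lee_wpmul2l//.
(* For [p = n] the moments coincide and [1 <= C + 1] suffices; for [p < n] the bound on [weight_s]
   is used. *)
move: pn; rewrite leq_eqVlt => /predU1P[->|pn].
  rewrite integral_sqr_fk_Qphi_random_weight_id// lee_pemull//.
  - by apply: integral_ge0 => x _; exact: sqre_ge0.
  - by rewrite lee_fin lerDr ltW.
apply: (le_integral_sqr_fk_Qphi_random_weight n) => //.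
- by rewrite addr_ge0// ltW.
- by move=> x; rewrite s_le// ltnW.
Qed.

Lemma le_random_weight_v_centred p (phi : X -> R) : (p <= n)%N ->
  measurable_fun [set: X] phi -> \int[fk_eta F n]_x (phi x)%:E = 0 ->
  fk_v F' p n (phi \o fst) <= (C + 1)%:E * fk_v F p n phi.
Proof.
move=> pn mphi phi0; rewrite [in leRHS]/fk_v phi0 (expe2 0) mule0 sube0.
apply: le_trans (le_random_weight_relative_moment _ _ pn mphi).
(* On the random-weight side the subtracted squared mean is simply dropped, being nonnegative. *)
by apply: geeDl; rewrite oppe_le0 sqre_ge0.
Qed.

Lemma le_random_weight_v_cst1 p : (p <= n)%N ->
  fk_v F' p n (cst 1%R \o fst) <= (C + 1)%:E * fk_v F p n (cst 1%R) + C%:E.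
Proof.
move=> pn; rewrite (fk_v_cst1 F') fk_v_cst1 muleDr_gt0 ?addr_gt0//.
rewrite -addeA -EFinM -EFinD.
(* The excess [C] exactly offsets the scaling of the subtracted 1 by [C + 1]. *)
have -> : ((C + 1) * (-1) + C = -1)%R by lra.
by rewrite leeD2r// le_random_weight_relative_moment.
Qed.

End asymptotic_variance_bounds.

(** * Summation over time *)

Theorem proposition3p3 (R : realType) (d d' : measure_display)
    (X : measurableType d) (U : measurableType d')
    (n : nat) (F : feynmanKac X R)
    (gamma_fin : forall p, (p <= n)%N -> fk_gamma F p [set: X] < +oo)
    (K : nat -> R.-pker X ~> U) (Gt : nat -> {mfun (X * U)%type >-> R})
    (Gt_gt0 : forall p xu, (0 < Gt p xu)%R)
    (Gt_unbiased : unbiased_weights F K Gt n)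
    (C : R) (C_gt0 : (0 < C)%R)
    (s_le : ereal_sup [set ereal_sup [set weight_s F K Gt n p x | x in [set: X]]
                      | p in [set p | (p <= n)%N]] <= (C + 1)%:E) :
  (forall phi : X -> R, measurable_fun [set: X] phi -> bounded_fun phi ->
    \int[fk_eta F n]_x (phi x)%:E = 0 ->
    fk_asymptotic_variance (random_weight_model F K Gt_gt0) n (phi \o fst)
      <= (C + 1)%:E * fk_asymptotic_variance F n phi) /\
  fk_asymptotic_variance (random_weight_model F K Gt_gt0) n (cst 1%R \o fst)
    <= (C + 1)%:E * fk_asymptotic_variance F n (cst 1%R) + (n%:R * C)%:E.
Proof.
have sC p x : (p <= n)%N -> weight_s F K Gt n p x <= (C + 1)%:E.
  move=> pn; apply: le_trans s_le.
  apply: (@le_trans _ _ (ereal_sup [set weight_s F K Gt n p x | x in [set: X]])).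
    by apply: ereal_sup_ubound; exists x.
  by apply: ereal_sup_ubound; exists p.
have C1_gt0 : (0 < C + 1)%R by rewrite addr_gt0.
have mulC1_sum m (a : nat -> \bar R) :
    (C + 1)%:E * \sum_(0 <= p < m) a p = \sum_(0 <= p < m) (C + 1)%:E * a p.
  by apply: big_morph => [x y|]; [exact: muleDr_gt0|exact: mule0].
split=> [phi mphi _ phi0|].
  rewrite /fk_asymptotic_variance mulC1_sum big_nat [leRHS]big_nat lee_sum// => p /=.
  by rewrite ltnS => pn; exact: (le_random_weight_v_centred n).
rewrite /fk_asymptotic_variance mulC1_sum !big_nat_recr//=.
(* Removing the vanishing terminal terms leaves [n] summands, hence an excess of [n] times [C] and
   not [n.+1] times. *)
rewrite (fk_v_terminal_cst1 (random_weight_model F K Gt_gt0)); last first.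
  by rewrite (random_weight_gamma_mass n)// gamma_fin.
rewrite fk_v_terminal_cst1 ?gamma_fin// mule0 !adde0.
(* The number of summands is separated from the horizon [n], which stays fixed inside [fk_v] during
   the induction. *)
suff le_sum m : (m <= n)%N ->
    \sum_(0 <= p < m) fk_v (random_weight_model F K Gt_gt0) p n (cst 1%R \o fst)
    <= \sum_(0 <= p < m) (C + 1)%:E * fk_v F p n (cst 1%R) + (m%:R * C)%:E.
  exact: le_sum.
elim: m => [_|m IH mn]; first by rewrite !big_geq// mul0r adde0.
rewrite !big_nat_recr//= mulrSr mulrDl mul1r (EFinD (_ * _)) addeACA.
by rewrite leeD ?IH ?(ltnW mn)// (le_random_weight_v_cst1 n)// ltnW.
Qed.
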